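(* Let $(\Omega,\mu)$ be a finite probability space and let $f\colon\Omega^n\to\{0,1\}$ with $\mathbb{E}[f]>0$. Let $r>1$ and let $d$ be a nonnegative integer with $d\le\frac14\log(1/\mathbb{E}[f])$. Suppose $\mathbb{E}[f_{S\to x}]\le r^{|S|}\mathbb{E}[f]$ for all $S\subseteq[n]$ with $|S|\le d$ and all $x\in\Omega^S$. Then \[\|f^{=d}\|_2^2\le \mathbb{E}[f]^2\left(\frac{2200\,r^2\log(1/\mathbb{E}[f])}{d}\right)^d.\]
   Context: Expectations and norms are with respect to the product measure $\mu^n$; $\log$ is natural; the convention $(\cdot)^0=1$ is used (so the bound for $d=0$ reads $\mathbb{E}[f]^2$). $f_{S\to x}(y)=f(x,y)$ denotes restriction, and $\mathbb{E}[f_{S\to x}]$ is its expectation over the remaining coordinates. For $i\in[n]$ let $E_i$ be the operator averaging over coordinate $i$ (i.e. $E_if(x)=\mathbb{E}_{y_i\sim\mu}f(x_1,\dots,y_i,\dots,x_n)$) and $L_i=I-E_i$; for $S\subseteq[n]$, $E_S=\prod_{i\in S}E_i$, $L_S=\prod_{i\in S}L_i$. The Efron–Stein components are $f^{=T}=E_{[n]\setminus T}L_Tf$, and $f^{=d}=\sum_{|T|=d}f^{=T}$. *)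

(* Defs.v *)
From HB Require Import structures.
From mathcomp Require Import all_boot all_order all_algebra.
From mathcomp Require Import reals exp.
Set Implicit Arguments. Unset Strict Implicit. Unset Printing Implicit Defensive.
Import Order.TTheory GRing.Theory Num.Theory.
Local Open Scope ring_scope.

Section EfronStein.
Variables (R : realType) (Omega : finType) (mu : Omega -> R) (n : nat).

Definition pt := {ffun 'I_n -> Omega}.

Definition pweight (x : pt) : R := \prod_(i < n) mu (x i).

Definition Exp (g : pt -> R) : R := \sum_(x : pt) pweight x * g x.

Definition norm2sq (g : pt -> R) : R := Exp (fun x => g x ^+ 2).

Definition merge (S : {set 'I_n}) (x y : pt) : pt :=
  [ffun i => if i \in S then x i else y i].

(* restriction f_{S -> x}, viewed as a function on Omega^n that only
   depends on the coordinates outside S *)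
Definition restr (S : {set 'I_n}) (x : pt) (f : pt -> R) : pt -> R :=
  fun y => f (merge S x y).

Definition Erestr (S : {set 'I_n}) (x : pt) (f : pt -> R) : R :=
  Exp (restr S x f).

Definition upd (x : pt) (i : 'I_n) (a : Omega) : pt :=
  [ffun j => if j == i then a else x j].

Definition Eop (i : 'I_n) (f : pt -> R) : pt -> R :=
  fun x => \sum_(a : Omega) mu a * f (upd x i a).
Definition Lop (i : 'I_n) (f : pt -> R) : pt -> R :=
  fun x => f x - Eop i f x.

(* E_S = prod_{i in S} E_i, L_S = prod_{i in S} L_i (the factors commute) *)
Definition EopS (S : {set 'I_n}) (f : pt -> R) : pt -> R :=
  foldr Eop f (enum S).
Definition LopS (S : {set 'I_n}) (f : pt -> R) : pt -> R :=
  foldr Lop f (enum S).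

Definition ES (T : {set 'I_n}) (f : pt -> R) : pt -> R :=
  EopS (~: T) (LopS T f).
Definition ESdeg (d : nat) (f : pt -> R) : pt -> R :=
  fun x => \sum_(T : {set 'I_n} | #|T| == d) ES T f x.

End EfronStein.

(* Main.v *)
Require Import Defs.
From HB Require Import structures.
From mathcomp Require Import all_boot all_order all_algebra.
From mathcomp Require Import reals exp.
From mathcomp Require Import boolp sequences ring lra.
Set Implicit Arguments. Unset Strict Implicit. Unset Printing Implicit Defensive.
Import Order.TTheory GRing.Theory Num.Theory.
Local Open Scope ring_scope.

(** Write g for the level-d part of f, W = |g|^2, and K = log(1/E f) / d.  As
    W = <f, g> and f is Boolean, W^(2k) <= (E f)^(2k-1) E[g^(2k)], and this is
    used with k = floor K.  The 2k-th moment of g is bounded by a hypercontractive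
    inequality tensorised one coordinate at a time: with rho^2 = 1/(5k) and T the
    noise operator of parameter rho,
      E[(T h)^(2k)] <= sum_S (3k)^(k|S|) E_x |(L_S h)(x, .)|_2^(2k),
    where x ranges over Omega^S.  For h = g the sup over x of
    |(L_S g)(x, .)|_2^2 is at most 4^|S| times the level-(d-|S|) weight of a
    restriction of f on S, which is controlled by induction on d: restrictions of
    f are again global, with E f replaced by r^|S| E f.  The induction keeps the
    parameter L >= log(1/E f) fixed, so that its hypothesis 4 d <= L persists. *)

(** * Power inequalities on the real line *)

Section ScalarInequalities.
Variable R : realType.
Implicit Types (A u v c t y r b L K W M : R) (k p d s : nat).

(** Convexity of the power function; multiplying the inductive bound by t leaves a surplus (p + 1)
    c^p (t - c)^2. It stands in for Jensen's inequality in [noise_step] and [Exp_jensen]. *)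
Lemma expr_ge_tangent p c t : 0 <= c -> 0 <= t ->
  c ^+ p.+1 + p.+1%:R * c ^+ p * (t - c) <= t ^+ p.+1.
Proof.
move=> c0 t0; elim: p => [|p IHp]; first by rewrite !expr1 expr0; lra.
have /= := ler_wpM2l t0 IHp.
have : 0 <= p.+1%:R * c ^+ p * (t - c) ^+ 2.
  by rewrite mulr_ge0 ?sqr_ge0 // mulr_ge0 ?ler0n ?exprn_ge0.
rewrite !exprS -(natr1 p.+1); set P := c ^+ p; set Q := t ^+ p.
by move=> h1 h2; nra.
Qed.

(** In the inductive step the new bound exceeds (1 + y) times the old one by y^2 + k y^2 (1 - k y),
    which is where k y <= 1 is needed. *)
Lemma expr1D_le_quadratic k y : -1 <= y -> k%:R * y <= 1 ->
  (1 + y) ^+ k <= 1 + k%:R * y + k%:R ^+ 2 * y ^+ 2.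
Proof.
move=> y1; elim: k => [|k IHk] hk; first by rewrite expr0; nra.
have k0 : 0 <= k%:R :> R by rewrite ler0n.
rewrite -natr1 in hk *.
have hk' : k%:R * y <= 1 by have [?|?] := lerP 0 y; nra.
have y1' : 0 <= 1 + y by lra.
have := ler_wpM2l y1' (IHk hk'); rewrite [_ ^+ k.+1]exprS => h.
apply: (le_trans h).
have : 0 <= y ^+ 2 * (1 - k%:R * y) * k%:R.
  by rewrite mulr_ge0 // mulr_ge0 ?sqr_ge0 ?subr_ge0.
have : 0 <= y ^+ 2 by rewrite sqr_ge0.
by nra.
Qed.

(* The linear term in [u] is kept exactly since it averages to zero; the
   coefficient of [v] is at most [k], to be absorbed by Bernoulli, and
   [(3 k v) ^+ k] takes over once [v] is large compared with [A / k]. *)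
Lemma quadratic_expr_le p A u v (rho : R) : (3 <= p)%N ->
  0 <= A -> 0 <= v -> u ^+ 2 <= A * v -> 0 <= rho ->
  rho ^+ 2 * (5 * p.+1%:R) = 1 ->
  (A + 2 * rho * u + rho ^+ 2 * v) ^+ p.+1 <=
  A ^+ p.+1 + p.+1%:R * A ^+ p * (2 * rho * u) + p.+1%:R * A ^+ p * v +
  (3 * p.+1%:R * v) ^+ p.+1.
Proof.
move=> p3 A0 v0 uAv rho0; have : 4 <= p.+1%:R :> R by rewrite ler_nat.
set k : R := p.+1%:R => k4 rhok.
set s := rho ^+ 2 in rhok *.
have s0 : 0 <= s by rewrite sqr_ge0.
(* The expansion of (1 + y)^k at y = (w + s v) / A needs k y <= 1. As s k = 1/5, this threshold
   gives |k w| <= (4/5) A, and with k >= 4 also k s v <= A / 25. *)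
have [hA|hA] := lerP (5 * k * v) (4 * A).
  have [A00|An0] := eqVneq A 0.
    have v00 : v = 0 by rewrite A00 in hA; nra.
    have u00 : u = 0 by apply/eqP; rewrite -sqrf_eq0; apply/eqP; nra.
    by rewrite A00 v00 u00 !mulr0 !addr0 expr0n /= add0r.
  have Agt0 : 0 < A by rewrite lt_neqAle eq_sym An0.
  set w := 2 * rho * u; set y := (w + s * v) / A.
  have yA : y * A = w + s * v by rewrite mulfVK.
  have w2 : w ^+ 2 <= 4 * s * (A * v).
    rewrite /w !exprMn -/s (_ : 2 ^+ 2 = 4); last by lra.
    by rewrite ler_wpM2l // mulr_ge0.
  have sk : s * k = 1 / 5 by lra.
  have wk2 : (k * w) ^+ 2 <= (4 / 5 * A) ^+ 2.
    rewrite exprMn; apply: (le_trans (ler_wpM2l (sqr_ge0 k) w2)).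
    have -> : k ^+ 2 * (4 * s * (A * v)) = 4 * (s * k) * (A * (k * v)) by ring.
    by rewrite sk; nra.
  have wk : `|k * w| <= 4 / 5 * A.
    rewrite -(@ler_pXn2r _ 2) ?nnegrE ?normr_ge0 ?real_normK ?num_real //.
    by rewrite mulr_ge0 ?divr_ge0.
  have svk : k * (s * v) <= 1 / 25 * A.
    have -> : k * (s * v) = (s * k) * v by ring.
    rewrite sk; nra.
  have sv0 : 0 <= s * v by rewrite mulr_ge0.
  move: wk; rewrite ler_norml => /andP[wk1 wk3].
  have kyA : k * y * A = k * w + k * (s * v) by rewrite -mulrA yA mulrDr.
  have ky1 : k * y <= 1 by rewrite -(ler_pM2r Agt0) kyA; lra.
  have ky0 : -1 <= k * y.
    have ? : 0 <= k * (s * v) by rewrite mulr_ge0 //; lra.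
    by rewrite -(ler_pM2r Agt0) kyA; lra.
  have y1 : -1 <= y by have [?|?] := lerP 0 y; nra.
  have -> : A + w + s * v = A * (1 + y) by rewrite mulrDr [A * y]mulrC yA; ring.
  rewrite exprMn.
  have h := ler_wpM2l (exprn_ge0 p.+1 A0) (@expr1D_le_quadratic p.+1 y y1 ky1).
  apply: (le_trans h); rewrite -/k.
  have /= := exprn_ge0 p.+1 (mulr_ge0 (mulr_ge0 (ler0n R 3) (ler0n R p.+1)) v0).
  rewrite -/k => E0.
  set E := (_ * v) ^+ _ in E0 *.
  (* What is left once the terms of order 0 and the linear term in w cancel. The square (k w)^2 uses
     up four fifths of k v A; k >= 4 leaves room for the other terms. *)
  suff : k ^+ 2 * y ^+ 2 * A + k * s * v <= k * v.
    rewrite [A ^+ p.+1]exprS.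
    have P0 := exprn_ge0 p A0; set P := A ^+ p in P0 *.
    have -> : A * P * (1 + k * y + k ^+ 2 * y ^+ 2) =
      A * P + k * P * (y * A) + P * (k ^+ 2 * y ^+ 2 * A) by ring.
    rewrite yA => /(ler_wpM2l P0); lra.
  rewrite -(ler_pM2r Agt0).
  have -> : (k ^+ 2 * y ^+ 2 * A + k * s * v) * A =
            k ^+ 2 * (y * A) ^+ 2 + s * k * v * A by ring.
  rewrite yA sk.
  have -> : k ^+ 2 * (w + s * v) ^+ 2 = (k * w) ^+ 2 +
     2 * (k * w) * (s * k) * v + (s * k) * v * (k * (s * v)) by ring.
  rewrite sk.
  have wk2' : (k * w) ^+ 2 <= 4 / 5 * k * (A * v).
    rewrite exprMn; apply: (le_trans (ler_wpM2l (sqr_ge0 k) w2)).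
    have -> : k ^+ 2 * (4 * s * (A * v)) = 4 * (s * k) * k * (A * v) by ring.
    by rewrite sk; nra.
  have := ler_wpM2r v0 wk3; have := ler_wpM2r v0 svk.
  have Av0 : 0 <= A * v by rewrite mulr_ge0.
  have : 4 * (A * v) <= k * (A * v) by rewrite ler_wpM2r.
  nra.
(* Large v: by AM-GM |w| <= A + s v, so the base on the left is at most 2 (A + s v), and A < (5/4) k
   v brings this below 3 k v. *)
set w := 2 * rho * u.
have w2 : w ^+ 2 <= 4 * s * (A * v).
  rewrite /w !exprMn -/s (_ : 2 ^+ 2 = 4); last by lra.
  by rewrite ler_wpM2l // mulr_ge0.
have sk : s * k = 1 / 5 by lra.
have sv0 : 0 <= s * v by rewrite mulr_ge0.
have wle : `|w| <= A + s * v.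
  rewrite -(@ler_pXn2r _ 2) ?nnegrE ?normr_ge0 ?real_normK ?num_real ?addr_ge0 //.
  apply: (le_trans w2); have := sqr_ge0 (A - s * v); nra.
move: wle; rewrite ler_norml => /andP[w3 w4].
have lhs : (A + w + s * v) ^+ p.+1 <= (3 * k * v) ^+ p.+1.
  have ? : s <= 1 / 20 by nra.
  have ? : s * v <= 1 / 20 * v by rewrite ler_wpM2r.
  have ? : 4 * v <= k * v by rewrite ler_wpM2r.
  by rewrite ler_pXn2r // ?nnegrE; nra.
(* The other terms on the right factor as A^p (A + k w + k v), nonnegative because (k w)^2 <= (4/5)
   A k v <= (A + k v)^2. *)
apply: (le_trans lhs); rewrite ler_wpDl // exprS.
have P0 := exprn_ge0 p A0; set P := A ^+ p in P0 *.
have -> : A * P + k * P * w + k * P * v = P * (A + k * w + k * v) by ring.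
rewrite mulr_ge0 //.
have : (k * w) ^+ 2 <= (A + k * v) ^+ 2.
  rewrite exprMn; apply: (le_trans (ler_wpM2l (sqr_ge0 k) w2)).
  have -> : k ^+ 2 * (4 * s * (A * v)) = 4 * (s * k) * (A * (k * v)) by ring.
  rewrite sk; have := sqr_ge0 (A - k * v).
  have : 0 <= A * (k * v) by rewrite !mulr_ge0 //; lra.
  nra.
have ? : 0 <= k * v by rewrite mulr_ge0 //; lra.
move=> kw2; have : `|k * w| <= A + k * v.
  by rewrite -(@ler_pXn2r _ 2) ?nnegrE ?normr_ge0 ?real_normK ?num_real ?addr_ge0.
by rewrite ler_norml => /andP[? _]; lra.
Qed.

(** Common source of both Cauchy-Schwarz inequalities: evaluate at the minimiser t = - U / V. If V =
    0 the polynomial is affine, and U <> 0 would give it the value -1 somewhere. *)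
Lemma discriminant_le (P U V : R) : 0 <= P -> 0 <= V ->
  (forall t, 0 <= P + 2 * t * U + t ^+ 2 * V) -> U ^+ 2 <= P * V.
Proof.
move=> P0; rewrite le_eqVlt => /predU1P[<- h|V0 h].
  rewrite mulr0 leNgt; apply/negP => U0.
  have U1 : U != 0 by rewrite -sqrf_eq0 gt_eqF.
  have := h (- (P + 1) / (2 * U)).
  have -> : 2 * (- (P + 1) / (2 * U)) * U = - (P + 1) by field.
  by rewrite mulr0; lra.
have /(ler_wpM2r (ltW V0)) := h (- U / V).
have -> : (P + 2 * (- U / V) * U + (- U / V) ^+ 2 * V) * V = P * V - U ^+ 2.
  by field; rewrite gt_eqF.
by rewrite mul0r subr_ge0.
Qed.

(** * Numerical estimates for the constants *)

Lemma expR1_le4 : expR 1 <= 4 :> R.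
Proof.
(* From 1 + x <= e^x at x = -1/2 one gets e^(1/2) <= 2, hence the 4. *)
have h : 1 / 2 <= expR (- (1 / 2)) :> R.
  by have := expR_ge1Dx (- (1 / 2) : R); lra.
rewrite expRN in h.
have e0 := expR_gt0 (1 / 2 : R).
have e2 : expR (1 / 2) <= 2 :> R.
  by have := ler_wpM2r (ltW e0) h; rewrite mulVf ?gt_eqF //; lra.
have -> : 1 = 1 / 2 + 1 / 2 :> R by lra.
by rewrite expRD; nra.
Qed.

Lemma expR_nat_le4X k : expR k%:R <= 4 ^+ k :> R.
Proof.
rewrite -[k%:R]mulr1 expRM_natl lerXn2r ?nnegrE ?expR_ge0 //.
exact: expR1_le4.
Qed.

(** With t = d - s > 0, (d / t)^t = (1 + s / t)^t <= e^s <= 4^s. This is the price of replacing the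
    denominator d - s of the induction hypothesis by d. *)
Lemma exprD_nat_le4X (d s : nat) : (s <= d)%N ->
  d%:R ^+ (d - s) <= 4 ^+ s * (d - s)%:R ^+ (d - s) :> R.
Proof.
move=> sd; case: (posnP (d - s)) => [->|t0].
  by rewrite !expr0 mulr1 -natrX ler1n expn_gt0.
set t := (d - s)%N in t0 *.
have t0' : 0 < t%:R :> R by rewrite ltr0n.
have -> : d%:R = (1 + s%:R / t%:R) * t%:R :> R.
  by rewrite mulrDl mul1r mulfVK ?gt_eqF // -natrD subnK.
rewrite exprMn ler_wpM2r ?exprn_ge0 ?ler0n //.
apply: (le_trans _ (expR_nat_le4X s)).
have -> : expR s%:R = expR (s%:R / t%:R) ^+ t :> R.
  by rewrite -expRM_natl mulrC mulfVK // gt_eqF.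
rewrite lerXn2r ?nnegrE ?expR_ge0 ?expR_ge1Dx //.
by rewrite addr_ge0 ?divr_ge0.
Qed.


(** Of the 16, one 4 comes from [EopS_LopS_sqr_le] and the other from [exprD_nat_le4X]. The factor
    r^(2 s) of the restricted mean cancels against the s missing powers of 2200 r^2 L / d, so the
    decay rate on the right is free of r. *)
Lemma derivative_weight_le r b L d s : 1 < r -> 0 < L -> (0 < s <= d)%N ->
  4 ^+ s * ((r ^+ s * b) ^+ 2 * (2200 * r ^+ 2 * L / (d - s)%:R) ^+ (d - s)) <=
  b ^+ 2 * (2200 * r ^+ 2 * L / d%:R) ^+ d * (16 / (2200 * (L / d%:R))) ^+ s.
Proof.
move=> r1 L0 /andP[s0 sd].
have d0 : 0 < d%:R :> R by rewrite ltr0n (leq_trans s0).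
have r0 : 0 < r by rewrite (lt_trans _ r1).
have r2 : 0 < r ^+ 2 by rewrite exprn_gt0.
set X := 2200 * r ^+ 2 * L / d%:R.
have X0 : 0 < X by rewrite divr_gt0 // !mulr_gt0.
set t := (d - s)%N.
have -> : 16 / (2200 * (L / d%:R)) = 16 * r ^+ 2 / X.
  by rewrite /X; field; rewrite !gt_eqF.
have -> : b ^+ 2 * X ^+ d * (16 * r ^+ 2 / X) ^+ s =
          b ^+ 2 * (X ^+ t * (16 * r ^+ 2) ^+ s).
  have <- : X ^+ s * (16 * r ^+ 2 / X) ^+ s = (16 * r ^+ 2) ^+ s.
    by rewrite -exprMn mulrC mulfVK ?gt_eqF.
  have -> : X ^+ d = X ^+ t * X ^+ s by rewrite -exprD subnK.
  by rewrite !mulrA.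
have Xt : (2200 * r ^+ 2 * L / t%:R) ^+ t <= X ^+ t * 4 ^+ s.
  case: (posnP t) => [->|t0]; first by rewrite !expr0 mul1r exprn_ege1 // ler1n.
  have t0' : 0 < t%:R :> R by rewrite ltr0n.
  have -> : 2200 * r ^+ 2 * L / t%:R = X * (d%:R / t%:R).
    by rewrite /X; field; rewrite !gt_eqF.
  rewrite exprMn ler_wpM2l ?exprn_ge0 ?(ltW X0) // expr_div_n.
  rewrite ler_pdivrMr ?exprn_gt0 //.
  exact: exprD_nat_le4X.
set y := (_ / t%:R) ^+ t in Xt *; set w := X ^+ t in Xt *.
have -> : (r ^+ s * b) ^+ 2 = (r ^+ 2) ^+ s * b ^+ 2.
  by rewrite exprMn -!exprM [(s * 2)%N]mulnC.
have -> : (16 * r ^+ 2) ^+ s = 4 ^+ s * 4 ^+ s * (r ^+ 2) ^+ s.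
  have -> : 16 = 4 * 4 :> R by lra.
  by rewrite [LHS]exprMn [X in X * _]exprMn.
have c0 : 0 <= 4 ^+ s * (r ^+ 2) ^+ s * b ^+ 2.
  by rewrite mulr_ge0 ?sqr_ge0 // mulr_ge0 ?exprn_ge0 // ltW.
have := ler_wpM2l c0 Xt.
have -> : 4 ^+ s * ((r ^+ 2) ^+ s * b ^+ 2 * y) =
          4 ^+ s * (r ^+ 2) ^+ s * b ^+ 2 * y.
  by rewrite !mulrA.
move=> h; apply: (le_trans h); rewrite le_eqVlt; apply/orP; left; apply/eqP.
by ring.
Qed.

(** The constant 2200 is spent here: with k = p + 1 <= K, each of p factors 3 k pairs with one 16 /
    (2200 K) to give at most 48 / 2200 <= 1 / 45, and the leftover 3 k is at most 45^p. *)
Lemma noise_weight_le1 p K : (3 <= p)%N -> p.+1%:R <= K ->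
  (3 * p.+1%:R) ^+ p.+1 * (16 / (2200 * K)) ^+ p <= 1.
Proof.
move=> p3 pK; have k0 : 0 < p.+1%:R :> R by rewrite ltr0n.
have K0 := lt_le_trans k0 pK.
have h : 3 * p.+1%:R * (16 / (2200 * K)) <= 1 / 45.
  have -> : 3 * p.+1%:R * (16 / (2200 * K)) = (48 * p.+1%:R) / (2200 * K).
    by field; rewrite gt_eqF.
  by rewrite ler_pdivrMr ?mulr_gt0 //; lra.
rewrite exprS -mulrA -exprMn.
have k3 : 3 * p.+1%:R <= 45 ^+ p :> R.
  have -> : 45 = 3 * 15 :> R by lra.
  rewrite exprMn; apply: ler_pM => //.
    have -> : 3 = 3 ^+ 1 :> R by rewrite expr1.
    by apply: ler_weXn2l; [lra | exact: leq_trans p3].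
  by rewrite -natrX ler_nat; exact: ltn_expl.
have h0 : 0 <= 3 * p.+1%:R * (16 / (2200 * K)).
  by rewrite mulr_ge0 ?divr_ge0 ?mulr_ge0 // ltW.
have hp : (3 * p.+1%:R * (16 / (2200 * K))) ^+ p <= (1 / 45) ^+ p.
  by rewrite lerXn2r ?nnegrE // divr_ge0.
apply: (@le_trans _ _ (45 ^+ p * (1 / 45) ^+ p)).
  by rewrite ler_pM // ?mulr_ge0 ?exprn_ge0.
by rewrite -exprMn (_ : 45 * (1 / 45) = 1 :> R) ?expr1n //; lra.
Qed.

(** Closing computation, where [al] is the mean of f and [M] the 2k-th moment of g, k = p + 1. The
    two last hypotheses bound W^(2k) by a multiple of W^k; cancel and take k-th roots. In 160 k = 16
    * 5 k * 2, the 5 k is rho^(-2), the 2 bounds 1 + z, and the 16 comes from [al_le]. *)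
Lemma level_weight_le (al b L W M z rho : R) p d : (0 < d)%N -> (3 <= p)%N ->
  0 < al -> al <= b -> 1 <= b * expR L -> 0 < W -> z <= 1 -> 0 <= 1 + z ->
  L <= p.+2%:R * d%:R -> rho ^+ 2 * (5 * p.+1%:R) = 1 ->
  W ^+ (2 * p.+1) <= al ^+ (2 * p.+1).-1 * M ->
  (rho ^+ d) ^+ (2 * p.+1) * M <= W ^+ p * ((1 + z) ^+ d * W) ->
  W <= b ^+ 2 * (160 * p.+1%:R) ^+ d.
Proof.
move=> d0 p3 al0 alb bL W0 z1 z0 LK; set k := p.+1 => rhop hJ hM.
have b0 := lt_le_trans al0 alb.
have k5 : 0 < 5 * k%:R :> R by rewrite mulr_gt0 ?ltr0n.
have rhoE : (rho ^+ d) ^+ (2 * k) * (5 * k%:R) ^+ (d * k) = 1.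
  by rewrite -exprM mulnCA exprM -exprMn rhop expr1n.
set Q := (5 * k%:R) ^+ (d * k) in rhoE.
have Q0 : 0 < Q by rewrite exprn_gt0.
have M_le : M <= Q * (2 ^+ d * W ^+ k).
  have := ler_wpM2l (ltW Q0) hM; rewrite [Q * (_ * M)]mulrCA mulrA rhoE mul1r.
  move=> h; apply: (le_trans h); rewrite ler_pM2l // mulrCA -exprSr.
  by rewrite ler_wpM2r ?exprn_ge0 ?(ltW W0) // lerXn2r ?nnegrE //; lra.
(* The exponent 2k - 1 lacks one factor [b], which costs e^L <= 4^((k + 1) d) <= 16^(d k) since k +
   1 <= 2 k. *)
have al_le : al ^+ (2 * k).-1 <= b ^+ (2 * k) * (16 ^+ d) ^+ k.
  apply: (@le_trans _ _ (b ^+ (2 * k).-1)).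
    by rewrite lerXn2r ?nnegrE ?(ltW al0) ?(ltW b0).
  apply: (@le_trans _ _ (b ^+ (2 * k).-1 * (b * expR L))).
    by rewrite ler_peMr // exprn_ge0 // ltW.
  rewrite mulrA -exprSr prednK // ler_pM2l ?exprn_gt0 //.
  apply: (@le_trans _ _ (expR (p.+2 * d)%:R)); first by rewrite ler_expR natrM.
  apply: (le_trans (expR_nat_le4X _)).
  rewrite -exprM (_ : 16 = 4 ^+ 2 :> R); last by lra.
  rewrite -exprM; apply: ler_weXn2l; first by lra.
  by rewrite mulnC mulnCA leq_mul2l mul2n -addnn addSn ltnS leq_addl orbT.
have M0 : 0 <= M.
  have h : 0 < al ^+ (2 * k).-1 * M by apply: lt_le_trans hJ; rewrite exprn_gt0.
  by rewrite ltW // -(pmulr_rgt0 _ (exprn_gt0 (2 * k).-1 al0)).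
have : W ^+ (2 * k) <=
    b ^+ (2 * k) * (16 ^+ d) ^+ k * (Q * (2 ^+ d * W ^+ k)).
  apply: (le_trans hJ); apply: ler_pM => //; first by rewrite exprn_ge0 // ltW.
have -> : W ^+ (2 * k) = W ^+ k * W ^+ k by rewrite mul2n -addnn exprD.
rewrite 2!mulrA ler_pM2r ?exprn_gt0 // => h.
have k0 : (0 < k)%N by [].
rewrite -(ler_pXn2r k0) ?nnegrE ?(ltW W0) //; last first.
  by rewrite mulr_ge0 ?sqr_ge0 // exprn_ge0 // mulr_ge0.
apply: (le_trans h).
have -> : 160 * k%:R = 16 * (5 * k%:R) * 2 :> R by lra.
have E (u v w : R) :
    ((u * v * w) ^+ d) ^+ k = (u ^+ d) ^+ k * v ^+ (d * k) * w ^+ (d * k).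
  by rewrite !exprMn -!exprM.
rewrite [leRHS]exprMn -[(b ^+ 2) ^+ k]exprM E -/Q !mulrA ler_pM2l; last first.
  by rewrite mulr_gt0 // mulr_gt0 ?exprn_gt0.
by apply: ler_weXn2l; [lra | rewrite leq_pmulr].
Qed.

End ScalarInequalities.

(** * Averaging operators and Efron-Stein components *)

Section EfronSteinTheory.
Variables (R : realType) (Omega : finType) (mu : Omega -> R) (n : nat).
Hypothesis mu_sum1 : \sum_(a : Omega) mu a = 1.
Implicit Types (f g h : pt Omega n -> R) (i j : 'I_n) (s t : seq 'I_n).
Implicit Types (S T A : {set 'I_n}) (x y : pt Omega n) (a b c z : R) (d : nat).

(* [Eop], [Lop] and the noise operators [Eop + rho * Lop] are all of the form
   [a + b * Eop], so one commutation theory serves them all. *)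
Definition mixop a b i f : pt Omega n -> R :=
  fun x => a * f x + b * Eop mu i f x.

Definition mixops a b s f := foldr (mixop a b) f s.

Definition invariant_at i f := forall x w, f (upd x i w) = f x.

Lemma upd_id x i : upd x i (x i) = x.
Proof. by apply/ffunP => j; rewrite ffunE; case: eqP => [->|]. Qed.

Lemma upd_same x i w w' : upd (upd x i w) i w' = upd x i w'.
Proof. by apply/ffunP => j; rewrite !ffunE; case: eqP. Qed.

Lemma upd_swap x i j w w' : i != j ->
  upd (upd x i w) j w' = upd (upd x j w') i w.
Proof.
move=> ij; apply/ffunP => l; rewrite !ffunE.
by case: (eqVneq l j) => [->|//]; rewrite eq_sym (negbTE ij).
Qed.

Lemma EopE : Eop mu (n := n) = mixop 0 1.
Proof.
by apply/funext => i; apply/funext => f; apply/funext => x; rewrite /mixop; lra.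
Qed.

Lemma LopE : Lop mu (n := n) = mixop 1 (-1).
Proof.
apply/funext => i; apply/funext => f; apply/funext => x.
by rewrite /mixop /Lop; lra.
Qed.

Lemma EopSE S f : EopS mu S f = mixops 0 1 (enum S) f.
Proof. by rewrite /EopS EopE. Qed.

Lemma LopSE S f : LopS mu S f = mixops 1 (-1) (enum S) f.
Proof. by rewrite /LopS LopE. Qed.

Lemma Eop_lin i a b f g :
  Eop mu i (fun x => a * f x + b * g x) =
  fun x => a * Eop mu i f x + b * Eop mu i g x.
Proof.
apply/funext => x; rewrite /Eop !mulr_sumr -big_split /=.
by apply: eq_bigr => w _; ring.
Qed.

Lemma invariant_Eop i f : invariant_at i (Eop mu i f).
Proof. by move=> x w; apply: eq_bigr => w' _; rewrite upd_same. Qed.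

Lemma Eop_invariant i f : invariant_at i f -> Eop mu i f = f.
Proof.
move=> fi; apply/funext => x; rewrite /Eop.
under eq_bigr do rewrite fi.
by rewrite -mulr_suml mu_sum1 mul1r.
Qed.

Lemma EopEop i f : Eop mu i (Eop mu i f) = Eop mu i f.
Proof. exact/Eop_invariant/invariant_Eop. Qed.

Lemma Eop_swap i j f : Eop mu i (Eop mu j f) = Eop mu j (Eop mu i f).
Proof.
have [->//|ij] := eqVneq i j; apply/funext => x; rewrite /Eop.
under eq_bigr do rewrite mulr_sumr.
rewrite exchange_big /=; apply: eq_bigr => w _; rewrite mulr_sumr.
by apply: eq_bigr => w' _; rewrite upd_swap //; ring.
Qed.

Lemma mixop_lin a b i c c' f g :
  mixop a b i (fun x => c * f x + c' * g x) =
  fun x => c * mixop a b i f x + c' * mixop a b i g x.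
Proof. by apply/funext => x; rewrite /mixop Eop_lin; ring. Qed.

Lemma mixop_swap a b a' b' i j f :
  mixop a b i (mixop a' b' j f) = mixop a' b' j (mixop a b i f).
Proof. by apply/funext => x; rewrite /mixop !Eop_lin Eop_swap; ring. Qed.

Lemma mixop_comp a b a' b' i f :
  mixop a b i (mixop a' b' i f) = mixop (a * a') (a * b' + b * a' + b * b') i f.
Proof. by apply/funext => x; rewrite /mixop Eop_lin EopEop; ring. Qed.

Lemma mixops_lin a b s c c' f g :
  mixops a b s (fun x => c * f x + c' * g x) =
  fun x => c * mixops a b s f x + c' * mixops a b s g x.
Proof. by elim: s => [//|i s IHs]; rewrite /= IHs mixop_lin. Qed.

Lemma mixops0 a b s : mixops a b s (fun=> 0) = fun=> 0.
Proof.
have /= := mixops_lin a b s 0 0 (fun=> 0) (fun=> 0).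
have -> : (fun _ : pt Omega n => 0 * 0 + 0 * 0 : R) = fun=> 0.
  by apply/funext => x; lra.
by move=> ->; apply/funext => x; lra.
Qed.

Lemma mixops_sum a b s (I : finType) (P : pred I) (F : I -> pt Omega n -> R) :
  mixops a b s (fun x => \sum_(t | P t) F t x) =
  fun x => \sum_(t | P t) mixops a b s (F t) x.
Proof.
apply/funext => x; elim: (index_enum I) => [|t r IHr].
  under [X in mixops _ _ _ X]eq_fun do rewrite big_nil.
  by rewrite mixops0 big_nil.
rewrite big_cons; case: ifPn => Pt.
  have -> : (fun x => \sum_(i <- t :: r | P i) F i x) =
            (fun x => 1 * F t x + 1 * \sum_(i <- r | P i) F i x).
    by apply/funext => y; rewrite big_cons Pt; ring.
  by rewrite mixops_lin IHr !mul1r.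
rewrite -IHr; congr (mixops _ _ _ _ x).
by apply/funext => y; rewrite big_cons (negbTE Pt).
Qed.

Lemma mixops_swap1 a b a' b' i s f :
  mixop a b i (mixops a' b' s f) = mixops a' b' s (mixop a b i f).
Proof. by elim: s => [//|j s IHs] /=; rewrite mixop_swap IHs. Qed.

Lemma mixops_swap a b a' b' s t f :
  mixops a b s (mixops a' b' t f) = mixops a' b' t (mixops a b s f).
Proof. by elim: s => [//|i s IHs] /=; rewrite IHs mixops_swap1. Qed.

Lemma mixops_cat a b s t f : mixops a b (s ++ t) f = mixops a b s (mixops a b t f).
Proof. exact: foldr_cat. Qed.

(** By commutation the order of the factors is immaterial, so any chosen element of [enum S] may be
    brought to the front. *)
Lemma perm_mixops a b s t f : perm_eq s t -> mixops a b s f = mixops a b t f.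
Proof.
elim: s t => [|i s IHs] t st; first by move: st; rewrite perm_sym => /perm_nilP ->.
have it : i \in t by rewrite -(perm_mem st) mem_head.
case/splitPr: it st => t1 t2; rewrite perm_sym perm_catC /= perm_cons => st.
rewrite mixops_cat /= (IHs (t1 ++ t2)) ?mixops_cat ?mixops_swap1 //.
by rewrite perm_sym perm_catC.
Qed.

(** As E_i is idempotent, the last two hypotheses say exactly that (a + b E_i)(a' + b' E_i) = a' +
    b' E_i. *)
Lemma mixops_absorb a b a' b' i s f : i \in s ->
  a * a' = a' -> a * b' + b * a' + b * b' = b' ->
  mixop a b i (mixops a' b' s f) = mixops a' b' s f.
Proof.
move=> si ea eb; rewrite (perm_mixops _ _ _ (perm_to_rem si)) /= mixop_comp.
by rewrite ea eb.
Qed.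

Lemma perm_enum_setU S T : [disjoint S & T] ->
  perm_eq (enum (S :|: T)) (enum S ++ enum T).
Proof.
move=> dST; apply: uniq_perm; rewrite ?enum_uniq //.
  rewrite cat_uniq !enum_uniq andbT; apply/hasPn => i /=; rewrite !mem_enum.
  by move=> iT; rewrite (disjointFl dST).
by move=> i; rewrite mem_cat !mem_enum inE.
Qed.

Lemma EopSU S T f : [disjoint S & T] ->
  EopS mu (S :|: T) f = EopS mu S (EopS mu T f).
Proof.
by move=> dST; rewrite !EopSE (perm_mixops _ _ _ (perm_enum_setU dST)) mixops_cat.
Qed.

Lemma LopSU S T f : [disjoint S & T] ->
  LopS mu (S :|: T) f = LopS mu S (LopS mu T f).
Proof.
by move=> dST; rewrite !LopSE (perm_mixops _ _ _ (perm_enum_setU dST)) mixops_cat.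
Qed.

Lemma EopS1 i f : EopS mu [set i] f = Eop mu i f.
Proof. by rewrite /EopS enum_set1. Qed.

Lemma LopS1 i f : LopS mu [set i] f = Lop mu i f.
Proof. by rewrite /LopS enum_set1. Qed.

Lemma EopSU1 i S f : i \notin S -> EopS mu (i |: S) f = Eop mu i (EopS mu S f).
Proof. by move=> iS; rewrite EopSU ?EopS1 // disjoints1. Qed.

Lemma LopSU1 i S f : i \notin S -> LopS mu (i |: S) f = Lop mu i (LopS mu S f).
Proof. by move=> iS; rewrite LopSU ?LopS1 // disjoints1. Qed.

Lemma EopS_LopS S T f : EopS mu S (LopS mu T f) = LopS mu T (EopS mu S f).
Proof. by rewrite !EopSE !LopSE mixops_swap. Qed.

Lemma mixops_id a b s f : (forall i, i \in s -> mixop a b i f = f) ->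
  mixops a b s f = f.
Proof.
elim: s => [//|i s IHs] h /=; rewrite IHs => [|j js]; first by rewrite h ?mem_head.
by rewrite h // inE js orbT.
Qed.

Lemma EopS_id S f : (forall i, i \in S -> Eop mu i f = f) -> EopS mu S f = f.
Proof.
move=> h; rewrite EopSE mixops_id // => i; rewrite mem_enum => /h.
by rewrite EopE.
Qed.

Lemma LopS_id S f : (forall i, i \in S -> Lop mu i f = f) -> LopS mu S f = f.
Proof.
move=> h; rewrite LopSE mixops_id // => i; rewrite mem_enum => /h.
by rewrite LopE.
Qed.

Lemma LopS_eq0 S i f : i \in S -> Lop mu i f = (fun=> 0) -> LopS mu S f = fun=> 0.
Proof.
move=> iS fi; rewrite LopSE.
rewrite (perm_mixops _ _ _ (perm_to_rem (s := enum S) (x := i) _)) ?mem_enum //=.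
by rewrite mixops_swap1 -LopE fi mixops0.
Qed.

Lemma Lop_Lop i f : Lop mu i (Lop mu i f) = Lop mu i f.
Proof. by rewrite LopE mixop_comp; congr mixop; lra. Qed.

Lemma Lop_LopS i S f : i \in S -> Lop mu i (LopS mu S f) = LopS mu S f.
Proof.
by move=> iS; rewrite LopSE LopE mixops_absorb ?mem_enum //; lra.
Qed.

Lemma Eop_EopS i S f : i \in S -> Eop mu i (EopS mu S f) = EopS mu S f.
Proof.
by move=> iS; rewrite EopSE EopE mixops_absorb ?mem_enum //; lra.
Qed.

Lemma Lop_Eop0 i f : Eop mu i f = f -> Lop mu i f = fun=> 0.
Proof. by move=> fi; apply/funext => x; rewrite /Lop fi subrr. Qed.

Lemma Lop_ES i T f :
  Lop mu i (ES mu T f) = if i \in T then ES mu T f else fun=> 0.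
Proof.
case: ifPn => iT; rewrite /ES.
  by rewrite EopS_LopS Lop_LopS // -EopS_LopS.
by apply: Lop_Eop0; rewrite Eop_EopS // inE.
Qed.

Lemma LopS_ES S T f :
  LopS mu S (ES mu T f) = if S \subset T then ES mu T f else fun=> 0.
Proof.
case: ifPn => [ST|/subsetPn[i iS iT]].
  by apply: LopS_id => i iS; rewrite Lop_ES (subsetP ST).
by apply: (LopS_eq0 iS); rewrite Lop_ES (negbTE iT).
Qed.

(** Orthogonality within one level: for distinct sets of equal size some i in T lies outside T', and
    L_i kills the component of T'. *)
Lemma ES_ES T T' f : #|T| = #|T'| ->
  ES mu T (ES mu T' f) = if T == T' then ES mu T f else fun=> 0.
Proof.
move=> cT; rewrite {1}/ES LopS_ES eqEcard -cT leqnn andbT; case: ifPn => TT'.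
  have -> : T = T' by apply/eqP; rewrite eqEcard TT' cT leqnn.
  by apply: EopS_id => i iT; rewrite Eop_EopS.
by rewrite EopSE mixops0.
Qed.

(** The operator (1 + z) - z E_i is I + z L_i, with eigenvalue 1 + z on the component of T if i is
    in T and 1 otherwise. Taking z = rho - 1 gives the noise operator. *)
Lemma mixops_ES z s T f :
  mixops (1 + z) (- z) s (ES mu T f) =
  fun x => (1 + z) ^+ count (mem T) s * ES mu T f x.
Proof.
elim: s => [|i s IHs] /=; first by apply/funext => x; rewrite mul1r.
rewrite IHs; set c := (1 + z) ^+ count _ s.
have -> : (fun x => c * ES mu T f x) = fun x => c * ES mu T f x + 0 * ES mu T f x.
  by apply/funext => x; ring.
rewrite mixop_lin; apply/funext => x.
have : mixop (1 + z) (- z) i (ES mu T f) x = ES mu T f x + z * Lop mu i (ES mu T f) x.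
  by rewrite /mixop /Lop; ring.
rewrite Lop_ES => ->; case: (i \in T); rewrite ?add1n ?add0n ?exprS -/c; ring.
Qed.

Lemma mixops_ESdeg z d f :
  mixops (1 + z) (- z) (enum 'I_n) (ESdeg mu d f) =
  fun x => (1 + z) ^+ d * ESdeg mu d f x.
Proof.
rewrite /ESdeg mixops_sum; apply/funext => x; rewrite mulr_sumr.
apply: eq_bigr => T /eqP dT; rewrite mixops_ES.
by rewrite -dT cardE -size_filter enumT.
Qed.

(** * Expectation: self-adjointness, positivity and Cauchy-Schwarz *)

Hypothesis mu_ge0 : forall w, 0 <= mu w.

Lemma pweight_ge0 x : 0 <= pweight mu x.
Proof. by apply: prodr_ge0 => i _. Qed.

(** Detailed balance for resampling coordinate i; it makes E_i self-adjoint. *)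
Lemma pweight_upd x i w :
  pweight mu x * mu w = pweight mu (upd x i w) * mu (x i).
Proof.
rewrite /pweight (bigD1 i) //= [in RHS](bigD1 i) //= ffunE eqxx.
rewrite [in RHS](eq_bigr (fun j => mu (x j))); first by ring.
by move=> j ji; rewrite ffunE (negbTE ji).
Qed.

Lemma Exp_lin a b f g :
  Exp mu (fun x => a * f x + b * g x) = a * Exp mu f + b * Exp mu g.
Proof.
by rewrite /Exp !mulr_sumr -big_split; apply: eq_bigr => x _ /=; ring.
Qed.

Lemma Exp_sum (I : finType) (P : pred I) (F : I -> pt Omega n -> R) :
  Exp mu (fun x => \sum_(t | P t) F t x) = \sum_(t | P t) Exp mu (F t).
Proof.
by rewrite /Exp exchange_big /=; apply: eq_bigr => x _; rewrite mulr_sumr.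
Qed.

Lemma ler_Exp f g : (forall x, f x <= g x) -> Exp mu f <= Exp mu g.
Proof. by move=> fg; apply: ler_sum => x _; rewrite ler_wpM2l ?pweight_ge0. Qed.

Lemma Exp_cst c : Exp mu (fun _ : pt Omega n => c) = c.
Proof.
rewrite /Exp -mulr_suml.
rewrite -(bigA_distr_bigA (fun (i : 'I_n) w => mu w)) /=.
by rewrite big1 ?mul1r // => i _.
Qed.

Lemma Exp_ge0 f : (forall x, 0 <= f x) -> 0 <= Exp mu f.
Proof. by move=> f0; rewrite -(Exp_cst 0) ler_Exp. Qed.

Lemma Exp_Eop_sym i f g :
  Exp mu (fun x => f x * Eop mu i g x) = Exp mu (fun x => Eop mu i f x * g x).
Proof.
pose G (p : pt Omega n * Omega) := pweight mu p.1 * mu p.2.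
transitivity (\sum_p G p * (f p.1 * g (upd p.1 i p.2))).
  rewrite -(pair_bigA _ (fun x w => G (x, w) * (f x * g (upd x i w)))) /=.
  apply: eq_bigr => x _; rewrite /Eop !mulr_sumr.
  by apply: eq_bigr => w _; rewrite /G /=; ring.
(* Exchanging the old and the new value of coordinate i is an involution that preserves the joint
   weight [G]. *)
pose swap (p : pt Omega n * Omega) := (upd p.1 i p.2, p.1 i).
have swapK : involutive swap.
  by case=> x w; rewrite /swap /= upd_same upd_id ffunE eqxx.
rewrite (reindex_inj (inv_inj swapK)) /=.
transitivity (\sum_p G p * (f (upd p.1 i p.2) * g p.1)).
  apply: eq_bigr => -[x w] _; rewrite upd_same upd_id /G /= -pweight_upd.
  by [].
rewrite -(pair_bigA _ (fun x w => G (x, w) * (f (upd x i w) * g x))) /=.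
apply: eq_bigr => x _; rewrite /Eop mulr_suml !mulr_sumr.
by apply: eq_bigr => w _; rewrite /G /=; ring.
Qed.

Lemma Exp_Eop i f : Exp mu (Eop mu i f) = Exp mu f.
Proof.
transitivity (Exp mu (fun x => 1 * Eop mu i f x)).
  by congr Exp; apply/funext => x; rewrite mul1r.
rewrite (Exp_Eop_sym i (fun=> 1)) Eop_invariant //.
by congr Exp; apply/funext => x; rewrite mul1r.
Qed.

Lemma Exp_EopS S f : Exp mu (EopS mu S f) = Exp mu f.
Proof. by rewrite /EopS; elim: (enum S) => [//|i s IHs]; rewrite /= Exp_Eop. Qed.

Lemma Exp_mixop_sym a b i f g :
  Exp mu (fun x => f x * mixop a b i g x) = Exp mu (fun x => mixop a b i f x * g x).
Proof.
transitivity (a * Exp mu (fun x => f x * g x) +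
              b * Exp mu (fun x => f x * Eop mu i g x)).
  by rewrite -Exp_lin; congr Exp; apply/funext => x; rewrite /mixop; ring.
rewrite Exp_Eop_sym -Exp_lin; congr Exp.
by apply/funext => x; rewrite /mixop; ring.
Qed.

Lemma Exp_mixops_sym a b s f g :
  Exp mu (fun x => f x * mixops a b s g x) =
  Exp mu (fun x => mixops a b s f x * g x).
Proof.
elim: s g => [//|i s IHs] g.
by rewrite /= mixops_swap1 IHs Exp_mixop_sym.
Qed.

Lemma Exp_ES_sym T f g :
  Exp mu (fun x => f x * ES mu T g x) = Exp mu (fun x => ES mu T f x * g x).
Proof.
by rewrite /ES EopSE LopSE Exp_mixops_sym Exp_mixops_sym mixops_swap -EopSE -LopSE.
Qed.

Lemma ES_sum T (I : finType) (P : pred I) (F : I -> pt Omega n -> R) :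
  ES mu T (fun x => \sum_(t | P t) F t x) =
  fun x => \sum_(t | P t) ES mu T (F t) x.
Proof.
rewrite /ES EopSE LopSE !mixops_sum; apply/funext => x.
by apply: eq_bigr => t _; rewrite EopSE LopSE.
Qed.

(** The components are self-adjoint projections, orthogonal within a level, so passing to the
    level-d part is an orthogonal projection. *)
Lemma norm2sq_ESdeg d f :
  norm2sq mu (ESdeg mu d f) = Exp mu (fun x => f x * ESdeg mu d f x).
Proof.
set g := ESdeg mu d f.
transitivity (Exp mu (fun x => \sum_(T : {set 'I_n} | #|T| == d) ES mu T f x * g x)).
  by congr Exp; apply/funext => x; rewrite expr2 {1}/g /ESdeg mulr_suml.
rewrite Exp_sum.
transitivity (\sum_(T : {set 'I_n} | #|T| == d) Exp mu (fun x => f x * ES mu T f x)).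
  apply: eq_bigr => T /eqP dT; rewrite -Exp_ES_sym; congr Exp.
  apply/funext => x; congr (_ * _).
  rewrite /g /ESdeg ES_sum (bigD1 T) ?dT //= big1 => [|T' /andP[/eqP dT' TT']].
    by rewrite ES_ES // eqxx addr0.
  by rewrite ES_ES ?dT ?dT' // eq_sym (negbTE TT').
rewrite -Exp_sum; congr Exp; apply/funext => x.
by rewrite /g /ESdeg mulr_sumr.
Qed.

Lemma ler_EopS S f g : (forall x, f x <= g x) ->
  forall x, EopS mu S f x <= EopS mu S g x.
Proof.
move=> fg; rewrite /EopS; elim: (enum S) => [//|i s IHs] x /=.
by apply: ler_sum => w _; rewrite ler_wpM2l.
Qed.

Lemma EopS_lin S a b f g :
  EopS mu S (fun x => a * f x + b * g x) =
  fun x => a * EopS mu S f x + b * EopS mu S g x.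
Proof. by rewrite !EopSE mixops_lin. Qed.

Lemma EopS_cst S c : EopS mu S (fun=> c) = fun=> c.
Proof. by apply: EopS_id => i _; apply: Eop_invariant. Qed.

Lemma EopS_ge0 S f : (forall x, 0 <= f x) -> forall x, 0 <= EopS mu S f x.
Proof. by move=> f0 x; have := ler_EopS S f0 x; rewrite EopS_cst. Qed.

(** Written as nested two-term combinations so that [EopS_lin], [Eop_lin] and [Exp_lin] apply
    directly. *)
Lemma sqrD_lin c f g : (fun x => (f x + c * g x) ^+ 2) =
  (fun x => 1 * (1 * f x ^+ 2 + 2 * c * (f x * g x)) + c ^+ 2 * g x ^+ 2).
Proof. by apply/funext => x; ring. Qed.

Lemma EopS_cauchy S f g x :
  EopS mu S (fun y => f y * g y) x ^+ 2 <=
  EopS mu S (fun y => f y ^+ 2) x * EopS mu S (fun y => g y ^+ 2) x.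
Proof.
apply: discriminant_le => [||t]; try by apply: EopS_ge0 => y; rewrite sqr_ge0.
have : 0 <= EopS mu S (fun y => (f y + t * g y) ^+ 2) x.
  by apply: EopS_ge0 => y; rewrite sqr_ge0.
by rewrite sqrD_lin !EopS_lin !mul1r.
Qed.

Lemma Exp_cauchy f g :
  Exp mu (fun y => f y * g y) ^+ 2 <=
  Exp mu (fun y => f y ^+ 2) * Exp mu (fun y => g y ^+ 2).
Proof.
apply: discriminant_le => [||t]; try by apply: Exp_ge0 => y; rewrite sqr_ge0.
have : 0 <= Exp mu (fun y => (f y + t * g y) ^+ 2).
  by apply: Exp_ge0 => y; rewrite sqr_ge0.
by rewrite sqrD_lin !Exp_lin !mul1r.
Qed.

Lemma Eop_sqr_le i f x : Eop mu i f x ^+ 2 <= Eop mu i (fun y => f y ^+ 2) x.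
Proof.
have := EopS_cauchy [set i] f (fun=> 1) x; rewrite expr1n EopS_cst mulr1 !EopS1.
by under [X in Eop _ _ X]eq_fun do rewrite mulr1.
Qed.

(** * Noise on one coordinate, and passage to high moments *)

Lemma Eop_pull i f g : invariant_at i f ->
  Eop mu i (fun x => f x * g x) = fun x => f x * Eop mu i g x.
Proof.
move=> fi; apply/funext => x; rewrite /Eop mulr_sumr.
by apply: eq_bigr => w _; rewrite fi; ring.
Qed.

Lemma EopS_Eop S i f : EopS mu S (Eop mu i f) = Eop mu i (EopS mu S f).
Proof. by rewrite !EopSE EopE mixops_swap1. Qed.

(** Split f = m + l with m = E_i f; noise turns it into m + rho l. Apply [quadratic_expr_le]
    pointwise to the averages P, U, V over [A] of m^2, m l, l^2. Since P and m do not depend on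
    coordinate i and E_i l = 0, the term in U averages to zero, and V may be replaced by E_i V in
    the term linear in V. *)
Lemma noise_step p (rho : R) A i f : (3 <= p)%N -> 0 <= rho ->
  rho ^+ 2 * (5 * p.+1%:R) = 1 -> i \notin A ->
  Exp mu (fun x => EopS mu A (fun y => mixop rho (1 - rho) i f y ^+ 2) x ^+ p.+1)
  <= Exp mu (fun x => EopS mu (i |: A) (fun y => f y ^+ 2) x ^+ p.+1) +
     (3 * p.+1%:R) ^+ p.+1 *
     Exp mu (fun x => EopS mu A (fun y => Lop mu i f y ^+ 2) x ^+ p.+1).
Proof.
move=> p3 rho0 rhop iA.
set m := Eop mu i f; set l := Lop mu i f.
have fE : f = fun x => m x + l x by apply/funext => x; rewrite /l /m /Lop; ring.
pose P := EopS mu A (fun y => m y ^+ 2).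
pose U := EopS mu A (fun y => m y * l y).
pose V := EopS mu A (fun y => l y ^+ 2).
have P0 x : 0 <= P x by apply: EopS_ge0 => y; rewrite sqr_ge0.
have V0 x : 0 <= V x by apply: EopS_ge0 => y; rewrite sqr_ge0.
have mi : invariant_at i m by exact: invariant_Eop.
have Pi : invariant_at i P.
  rewrite /P -(@Eop_invariant i (fun y => m y ^+ 2)) => [|x w]; last by rewrite mi.
  by rewrite EopS_Eop; exact: invariant_Eop.
have Ppi q : invariant_at i (fun x => P x ^+ q) by move=> x w; rewrite Pi.
have El : Eop mu i l = fun=> 0.
  have := Lop_Eop0 (EopEop i f); rewrite /l !LopE !EopE => h.
  by rewrite mixop_swap.
have EU : Eop mu i U = fun=> 0.
  rewrite /U -EopS_Eop (Eop_pull _ mi) El.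
  by rewrite -(EopS_cst A 0); congr EopS; apply/funext => x; rewrite mulr0.
have EV : EopS mu (i |: A) (fun y => f y ^+ 2) = fun x => P x + Eop mu i V x.
  rewrite EopSU1 // -EopS_Eop fE.
  have -> : (fun y => (m y + l y) ^+ 2) =
            (fun y => (m y + 1 * l y) ^+ 2) by apply/funext => y; rewrite mul1r.
  rewrite sqrD_lin !Eop_lin (Eop_pull _ mi) El.
  rewrite (@Eop_invariant i (fun y => m y ^+ 2)) => [|x w]; last by rewrite mi.
  rewrite !EopS_lin EopS_Eop -/V -/P; apply/funext => x.
  have -> : (fun y => m y * 0) = (fun=> 0) by apply/funext => y; rewrite mulr0.
  by rewrite EopS_cst; ring.
have TE x : EopS mu A (fun y => mixop rho (1 - rho) i f y ^+ 2) x =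
    P x + 2 * rho * U x + rho ^+ 2 * V x.
  have -> : (fun y => mixop rho (1 - rho) i f y ^+ 2) =
            (fun y => (m y + rho * l y) ^+ 2).
    by apply/funext => y; rewrite /mixop /l /Lop -/m; congr (_ ^+ _); ring.
  by rewrite sqrD_lin !EopS_lin -/P -/U -/V; ring.
set k : R := p.+1%:R.
have ExpEi g : Exp mu (fun x => P x ^+ p * g x) =
               Exp mu (fun x => P x ^+ p * Eop mu i g x).
  by rewrite -(Exp_Eop i) Eop_pull.
rewrite EV; apply: (@le_trans _ _ (Exp mu (fun x =>
  1 * (1 * (1 * P x ^+ p.+1 + (2 * k * rho) * (P x ^+ p * U x)) +
       k * (P x ^+ p * V x)) +
  (3 * k) ^+ p.+1 * V x ^+ p.+1))).
  apply: ler_Exp => x; rewrite TE.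
  have := quadratic_expr_le p3 (P0 x) (V0 x) (EopS_cauchy A m l x) rho0 rhop.
  rewrite -/k -/(P x) -/(U x) -/(V x) [(3 * k * V x) ^+ _]exprMn => h.
  apply: (le_trans h); rewrite le_eqVlt; apply/orP; left; apply/eqP; ring.
rewrite !Exp_lin ExpEi [X in k * X]ExpEi EU.
have -> : (fun x => P x ^+ p * 0) = (fun=> 0) by apply/funext => x; rewrite mulr0.
rewrite Exp_cst mulr0 addr0 !mul1r lerD2r.
rewrite -[Exp mu (fun x => P x ^+ p.+1)]mul1r -Exp_lin.
(* By the tangent bound at P, P^k + k P^p E_i V <= (P + E_i V)^k, and P + E_i V is the average of
   f^2 over [i |: A]. *)
apply: ler_Exp => x.
have EV0 : 0 <= Eop mu i V x by rewrite -EopS1; exact: EopS_ge0.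
have := expr_ge_tangent p (P0 x) (addr_ge0 (P0 x) EV0).
by rewrite -/k [P x + _]addrC addrK mul1r mulrA.
Qed.

(** Since f = f^2, Cauchy-Schwarz gives E[f g]^2 <= E[f] E[f g^2]; convexity under the density f /
    E[f] then raises g^2 to the power p + 1. *)
Lemma Exp_jensen f g p : (forall x, f x = 0 \/ f x = 1) -> 0 < Exp mu f ->
  Exp mu (fun x => f x * g x) ^+ (2 * p.+1) <=
  Exp mu f ^+ (2 * p.+1).-1 * Exp mu (fun x => (g x ^+ 2) ^+ p.+1).
Proof.
move=> f01 al0; set al := Exp mu f in al0 *.
have f2 x : f x ^+ 2 = f x by case: (f01 x) => ->; rewrite ?expr0n ?expr1n.
have f0 x : 0 <= f x by case: (f01 x) => ->.
have f1 x : f x <= 1 by case: (f01 x) => ->.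
set m := Exp mu (fun x => f x * g x ^+ 2).
have m0 : 0 <= m by apply: Exp_ge0 => x; rewrite mulr_ge0 ?sqr_ge0.
have h1 : Exp mu (fun x => f x * g x) ^+ 2 <= al * m.
  have := Exp_cauchy f (fun x => f x * g x).
  have -> : (fun y => f y * (f y * g y)) = fun y => f y * g y.
    by apply/funext => y; rewrite mulrA -expr2 f2.
  have -> : (fun y => (f y * g y) ^+ 2) = fun y => f y * g y ^+ 2.
    by apply/funext => y; rewrite exprMn f2.
  by have -> : (fun y => f y ^+ 2) = f by apply/funext => y; rewrite f2.
have h2 : al * m ^+ p.+1 <= al ^+ p.+1 * Exp mu (fun x => (g x ^+ 2) ^+ p.+1).
  (* Under the density f / E[f] the mean of t is m, so the tangent is taken at m and no division by
     [al] occurs. The weight f is dropped on the right by f <= 1. *)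
  pose t x := al * g x ^+ 2.
  have : Exp mu (fun x => (m ^+ p.+1 - p.+1%:R * m ^+ p * m) * f x +
      p.+1%:R * m ^+ p * al * (f x * g x ^+ 2)) <=
      Exp mu (fun x => al ^+ p.+1 * (g x ^+ 2) ^+ p.+1 + 0 * 0).
    apply: ler_Exp => x.
    have t0 : 0 <= t x by rewrite mulr_ge0 ?sqr_ge0 // ltW.
    have := ler_wpM2l (f0 x) (expr_ge_tangent p m0 t0).
    have : f x * t x ^+ p.+1 <= t x ^+ p.+1 by rewrite ler_piMl ?exprn_ge0.
    rewrite /t !exprMn => ha hb; lra.
  rewrite !Exp_lin -/m -/al mul0r addr0; apply: le_trans.
  by rewrite le_eqVlt; apply/orP; left; apply/eqP; ring.
rewrite exprM; apply: (@le_trans _ _ ((al * m) ^+ p.+1)).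
  by rewrite lerXn2r ?nnegrE ?sqr_ge0 // mulr_ge0 // ltW.
rewrite exprMn [al ^+ p.+1]exprSr -mulrA.
apply: (le_trans (ler_wpM2l (exprn_ge0 p (ltW al0)) h2)).
rewrite mulrA -exprD le_eqVlt; apply/orP; left; apply/eqP; congr (_ ^+ _ * _).
by rewrite mulnS add2n /= mul2n -addnn addnS.
Qed.

(** * Restrictions and derivatives of the level-d part *)

Lemma mixop_restr S x f a b i : i \notin S ->
  mixop a b i (restr S x f) = restr S x (mixop a b i f).
Proof.
move=> iS; apply/funext => y; rewrite /mixop /restr; congr (_ + _ * _).
apply: eq_bigr => w _; congr (_ * f _); apply/ffunP => j; rewrite !ffunE.
by case: (eqVneq j i) => [->|]; rewrite ?(negbTE iS).
Qed.

Lemma Eop_restr S x f i : i \in S -> Eop mu i (restr S x f) = restr S x f.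
Proof.
move=> iS; apply: Eop_invariant => y w; rewrite /restr; congr f.
by apply/ffunP => j; rewrite !ffunE; case: (eqVneq j i) => [->|//]; rewrite iS.
Qed.

Lemma mixops_restr S x f a b s : (forall i, i \in s -> i \notin S) ->
  mixops a b s (restr S x f) = restr S x (mixops a b s f).
Proof.
elim: s => [//|i s IHs] h /=; rewrite IHs => [|j js].
  by rewrite mixop_restr // h ?mem_head.
by rewrite h // inE js orbT.
Qed.

Lemma EopS_restr S T x f : [disjoint T & S] ->
  EopS mu T (restr S x f) = restr S x (EopS mu T f).
Proof.
move=> dTS; rewrite !EopSE mixops_restr // => i; rewrite mem_enum => iT.
by rewrite (disjointFr dTS).
Qed.

Lemma LopS_restr S T x f : [disjoint T & S] ->
  LopS mu T (restr S x f) = restr S x (LopS mu T f).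
Proof.
move=> dTS; rewrite !LopSE mixops_restr // => i; rewrite mem_enum => iT.
by rewrite (disjointFr dTS).
Qed.

Lemma EopS_eq S f x y : (forall i, i \notin S -> x i = y i) ->
  EopS mu S f x = EopS mu S f y.
Proof.
move=> xy; have {xy} : forall i, i \notin enum S -> x i = y i.
  by move=> i; rewrite mem_enum; exact: xy.
rewrite /EopS; elim: (enum S) x y => [|i s IHs] x y xy /=.
  by congr f; apply/ffunP => i; exact: xy.
apply: eq_bigr => w _; congr (_ * _); apply: IHs => j js; rewrite !ffunE.
by case: eqP => // /eqP ji; rewrite xy // inE negb_or ji.
Qed.

(** With the coordinates in [S] frozen at x, averaging over all the others leaves a constant
    function of y, which is its own expectation. *)
Lemma ErestrE S x f : Erestr mu S x f = EopS mu (~: S) f x.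
Proof.
rewrite /Erestr -(Exp_EopS (~: S)) EopS_restr; last first.
  by rewrite disjoint_sym disjoints_subset setCK.
rewrite -[RHS](Exp_cst); congr Exp; apply/funext => y; apply: EopS_eq => i.
by rewrite inE negbK ffunE => ->.
Qed.

Lemma EopS_setT f x : EopS mu setT f x = Exp mu f.
Proof.
rewrite -(setC0) -ErestrE; congr Exp; apply/funext => y; congr f.
by apply/ffunP => i; rewrite ffunE inE.
Qed.

(* [ESdeg d f] with the redundant operator [LopS S] removed from the components
   it is applied in; its restrictions are components of restrictions of [f]. *)
Definition predegree S d f : pt Omega n -> R :=
  fun x => \sum_(T : {set 'I_n} | (#|T| == d) && (S \subset T))
             EopS mu (~: T) (LopS mu (T :\: S) f) x.

(** L_S kills the components of sets T not containing [S]; for the others L_T = L_S L_(T \ S), and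
    L_S fixes the component. *)
Lemma LopS_predegree S d f :
  LopS mu S (ESdeg mu d f) = LopS mu S (predegree S d f).
Proof.
rewrite !LopSE /ESdeg /predegree !mixops_sum; apply/funext => x.
rewrite [RHS]big_mkcondr; apply: eq_bigr => T _ /=.
rewrite -!LopSE LopS_ES; case: ifP => // ST.
rewrite -EopS_LopS -LopSU -?setI_eq0; last first.
  by apply/eqP/setP => i; rewrite !inE; case: (i \in S); rewrite ?andbF.
by rewrite /ES -[T in LopS mu T](setID T S) (setIidPr ST).
Qed.

(** Sets containing [S] correspond to their differences with [S]. Components of the restriction
    indexed by sets meeting [S] vanish, as it does not depend on the coordinates in [S]. *)
Lemma restr_predegree S x d f : (#|S| <= d)%N ->
  restr S x (predegree S d f) = ESdeg mu (d - #|S|) (restr S x f).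
Proof.
move=> Sd; apply/funext => y; rewrite /ESdeg (bigID (fun T => [disjoint T & S])) /=.
rewrite [X in _ + X]big1 ?addr0; last first.
  move=> T /andP[_]; rewrite -setI_eq0 => /set0Pn[i]; rewrite inE => /andP[iT iS].
  rewrite /ES (LopS_eq0 iT); last by apply: Lop_Eop0; rewrite Eop_restr.
  by rewrite EopS_cst.
rewrite {1}/restr /predegree.
rewrite (reindex_onto (fun T => S :|: T) (fun T => T :\: S)) /=; last first.
  by move=> T /andP[_ ST]; rewrite setUC -[RHS](setID T S) (setIidPr ST) setUC.
have tE T : ((S :|: T) :\: S == T) = [disjoint T & S].
  rewrite setDUl setDv set0U; apply/eqP/idP => [<-|/setDidPl //].
  by rewrite -setI_eq0 setIC setIDA [S :&: T]setIC -setIDA setDv setI0.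
apply: eq_big => [T|T /andP[_ /eqP TS]].
  rewrite tE subsetUl andbT; case: (boolP [disjoint T & S]) => dTS; rewrite ?andbF //.
  rewrite !andbT cardsU setIC disjoint_setI0 // cards0 subn0.
  by rewrite -[RHS](eqn_add2l #|S|) subnKC.
have dTS : [disjoint T & S] by rewrite -tE TS.
rewrite TS /ES LopS_restr // -[LHS]/(restr S x (EopS mu _ _) y).
(* The extra averaging over [S] acts trivially on a restriction. *)
have -> : ~: T = ~: (S :|: T) :|: S.
  apply/setP => i; rewrite !inE.
  case: (boolP (i \in S)) => iS; rewrite ?orbT ?orbF //.
  by rewrite (disjointFl dTS).
rewrite EopSU; last by rewrite disjoint_sym disjoints_subset setCK subsetUl.
rewrite [EopS mu S _]EopS_id => [|i]; last exact: Eop_restr.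
by rewrite EopS_restr // disjoint_sym disjoints_subset setCK subsetUl.
Qed.

Lemma EopS_predegree_sqr S x d f : (#|S| <= d)%N ->
  EopS mu (~: S) (fun y => predegree S d f y ^+ 2) x =
  norm2sq mu (ESdeg mu (d - #|S|) (restr S x f)).
Proof. by move=> Sd; rewrite -ErestrE -restr_predegree. Qed.

(** Each coordinate costs a factor 4: (h - E_i h)^2 <= 2 h^2 + 2 E_i(h^2). The bound must be uniform
    in x because E_i moves the point. *)
Lemma EopS_LopS_sqr_le A S f (M : R) :
  (forall x, EopS mu A (fun y => f y ^+ 2) x <= M) ->
  forall x, EopS mu A (fun y => LopS mu S f y ^+ 2) x <= 4 ^+ #|S| * M.
Proof.
rewrite /LopS cardE; elim: (enum S) => [|i s IHs] fM x /=; first by rewrite mul1r.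
set h := foldr _ _ s in IHs *; set K := 4 ^+ size s * M in IHs *.
have hK := IHs fM; rewrite exprS -mulrA -/K.
pose h2 y := h y ^+ 2.
apply: (@le_trans _ _ (EopS mu A (fun y => 2 * h2 y + 2 * Eop mu i h2 y) x)).
  apply: ler_EopS => y; rewrite /Lop; have := Eop_sqr_le i h y.
  by have := sqr_ge0 (h y + Eop mu i h y); rewrite -/h2 /h2; lra.
rewrite EopS_lin EopS_Eop.
have E2K : Eop mu i (EopS mu A h2) x <= K.
  have /= := ler_EopS [set i] (f := EopS mu A h2) (g := fun=> K) hK x.
  by rewrite EopS_cst EopS1.
have := hK x; rewrite -/h2; lra.
Qed.

Lemma LopS_ESdeg_eq0 S d f : (d < #|S|)%N -> LopS mu S (ESdeg mu d f) = fun=> 0.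
Proof.
move=> dS; rewrite LopS_predegree LopSE /predegree mixops_sum.
apply/funext => x; rewrite big1 // => T /andP[/eqP dT /subset_leq_card].
by rewrite dT leqNgt dS.
Qed.

(** * Tensorised hypercontractivity *)

(* Intermediate stage of the tensorisation: the coordinates in [A] are already
   averaged in square, those in [S] differentiated, those in [s] pending. *)
Lemma noise_moment_le p (rho eta W kap z : R) f A S s :
  (3 <= p)%N -> 0 <= rho -> rho ^+ 2 * (5 * p.+1%:R) = 1 -> 0 <= W -> 0 <= eta ->
  (forall S' x, EopS mu (~: S') (fun y => LopS mu S' f y ^+ 2) x <=
     W * eta ^+ #|S'|) ->
  uniq s -> (forall i, (i \in s) = (i \notin A) && (i \notin S)) ->
  [disjoint A & S] ->
  kap = (3 * p.+1%:R) ^+ p.+1 -> z = kap * eta ^+ p ->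
  kap ^+ #|S| *
  Exp mu (fun x => EopS mu A
    (fun y => mixops rho (1 - rho) s (LopS mu S f) y ^+ 2) x ^+ p.+1)
  <= W ^+ p * z ^+ #|S| *
     Exp mu (fun x => LopS mu S f x * mixops (1 + z) (- z) s (LopS mu S f) x).
Proof.
move=> p3 rho0 rhop W0 eta0 hS us sE dAS kapE zE.
have kap0 : 0 <= kap by rewrite kapE exprn_ge0 // mulr_ge0.
have z0 : 0 <= z by rewrite zE mulr_ge0 ?exprn_ge0.
elim: s A S us sE dAS => [|i s IHs] A S /= us sE dAS.
  (* With nothing pending, p of the p + 1 factors are bounded by the uniform hypothesis and one is
     kept; kap^|S| (W eta^|S|)^p = W^p z^|S|. *)
  have AE : A = ~: S.
    apply/setP => j; have /esym := sE j; rewrite !inE.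
    case: (boolP (j \in A)) => jA /=; last by move/negbFE ->.
    by rewrite (disjointFr dAS).
  have h x : kap ^+ #|S| * EopS mu A (fun y => LopS mu S f y ^+ 2) x ^+ p.+1 <=
     W ^+ p * z ^+ #|S| * EopS mu A (fun y => LopS mu S f y ^+ 2) x.
    set e := EopS _ _ _ x.
    have e0 : 0 <= e by apply: EopS_ge0 => y; rewrite sqr_ge0.
    rewrite exprSr mulrA ler_wpM2r //.
    have -> : W ^+ p * z ^+ #|S| = kap ^+ #|S| * (W * eta ^+ #|S|) ^+ p.
      by rewrite zE !exprMn -!exprM [(p * _)%N]mulnC; ring.
    rewrite ler_wpM2l ?exprn_ge0 // lerXn2r ?nnegrE // ?mulr_ge0 ?exprn_ge0 //.
    by rewrite /e AE; exact: hS.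
  have := ler_Exp (fun x => _ : _ <= _); move/(_ _ _ h).
  have ExpZ c g : Exp mu (fun x => c * g x) = c * Exp mu g.
    rewrite /Exp mulr_sumr; apply: eq_bigr => x _; ring.
  by rewrite !ExpZ Exp_EopS.
move/andP: us => [iNs us].
have /esym/andP[iA iS] : true = (i \notin A) && (i \notin S).
  by rewrite -sE mem_head.
have sEA j : (j \in s) = (j \notin i |: A) && (j \notin S).
  have := sE j; rewrite !inE; case: (eqVneq j i) => [->|] //=.
  by rewrite (negbTE iNs).
have sES j : (j \in s) = (j \notin A) && (j \notin i |: S).
  by rewrite sEA !inE; case: (j == i); rewrite ?andbF.
have dA : [disjoint i |: A & S].
  by rewrite -setI_eq0 setIUl setU_eq0 !setI_eq0 disjoints1 iS.
have dS : [disjoint A & i |: S].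
  rewrite disjoint_sym -setI_eq0 setIUl setU_eq0 !setI_eq0 disjoints1 iA.
  by rewrite disjoint_sym.
(* The two terms of [noise_step] are the two fates of i: averaged, joining [A], or differentiated,
   joining [S]. *)
have hA := IHs _ _ us sEA dA; have hS' := IHs _ _ us sES dS.
rewrite LopSU1 // cardsU1 iS add1n !exprS in hS'.
set g := LopS mu S f in hA hS' *.
have step := noise_step (mixops rho (1 - rho) s g) p3 rho0 rhop iA.
apply: (le_trans (ler_wpM2l (exprn_ge0 #|S| kap0) step)).
rewrite -kapE LopE mixops_swap1 -LopE mulrDr.
(* The bounds for the two branches recombine through I + z L_i: as L_i is a self-adjoint projection
   commuting with the rest, it can be put on both sides of the inner product. *)
have -> : Exp mu (fun x => g x * mixop (1 + z) (- z) i (mixops (1 + z) (- z) s g) x)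
   = Exp mu (fun x => g x * mixops (1 + z) (- z) s g x) +
     z * Exp mu (fun x => Lop mu i g x * mixops (1 + z) (- z) s (Lop mu i g) x).
  have -> : Exp mu (fun x => Lop mu i g x * mixops (1 + z) (- z) s (Lop mu i g) x) =
            Exp mu (fun x => g x * Lop mu i (mixops (1 + z) (- z) s g) x).
    rewrite LopE -mixops_swap1 -LopE.
    rewrite [in LHS]LopE -Exp_mixop_sym -LopE Lop_Lop.
    by rewrite LopE.
  rewrite -[Exp mu (fun x => g x * mixops _ _ s g x)]mul1r -Exp_lin.
  by congr Exp; apply/funext => x; rewrite /mixop /Lop; ring.
have := lerD hA hS'; lra.
Qed.

(** * Induction on the level *)

Lemma pt_inhabited : inhabited (pt Omega n).
Proof.
case: (pickP (fun _ : pt Omega n => true)) => [x _|nox]; first by [].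
by have := Exp_cst 1; rewrite /Exp big_pred0 // => /eqP; rewrite eq_sym oner_eq0.
Qed.

Lemma restr_restr S T x y f :
  restr T y (restr S x f) = restr (S :|: T) (Defs.merge S x y) f.
Proof.
apply/funext => u; rewrite /restr; congr f; apply/ffunP => j; rewrite !ffunE !inE.
by case: (j \in S).
Qed.

Lemma norm2sq_ESdeg0 f : norm2sq mu (ESdeg mu 0 f) = Exp mu f ^+ 2.
Proof.
have -> : ESdeg mu 0 f = fun=> Exp mu f.
  apply/funext => x; rewrite /ESdeg (big_pred1 set0) => [|T]; last by rewrite cards_eq0.
  by rewrite /ES setC0 /LopS enum_set0 EopS_setT.
exact: Exp_cst.
Qed.

(** Here [be] is only an upper bound for the mean of f, so that restrictions, whose means may be far
    smaller or even zero, meet the same hypotheses with r^|S| [be]. *)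
Lemma level_inequality d f (r be L : R) :
  (forall x, f x = 0 \/ f x = 1) -> 1 < r -> 0 < be -> 1 <= be * expR L ->
  4 * d%:R <= L ->
  (forall S x, (#|S| <= d)%N -> Erestr mu S x f <= r ^+ #|S| * be) ->
  norm2sq mu (ESdeg mu d f) <= be ^+ 2 * (2200 * r ^+ 2 * L / d%:R) ^+ d.
Proof.
elim/ltn_ind: d f be => d IHd f be f01 r1 be0 beL dL glob.
have f0 x : 0 <= f x by case: (f01 x) => ->.
have r0 : 0 < r by rewrite (lt_trans _ r1).
have al_be : Exp mu f <= be.
  case: pt_inhabited => x; have := glob set0 x.
  by rewrite cards0 expr0 mul1r ErestrE setC0 EopS_setT; apply.
have al_ge0 : 0 <= Exp mu f by exact: Exp_ge0.
(* At d = 0 the quotient by zero is raised to the power 0, and the bound reads [be] squared. *)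
case: (posnP d) => [d0|d0].
  by rewrite d0 norm2sq_ESdeg0 expr0 mulr1 lerXn2r ?nnegrE // ltW.
have d0' : 0 < d%:R :> R by rewrite ltr0n.
have d1 : 1 <= d%:R :> R by rewrite ler1n.
have L0 : 0 < L by lra.
set g := ESdeg mu d f; set W := norm2sq mu g; set B := be ^+ 2 * _.
have B0 : 0 <= B.
  by rewrite mulr_ge0 ?sqr_ge0 // exprn_ge0 // divr_ge0 ?mulr_ge0 ?sqr_ge0 // ltW.
(* Assuming B < W, bounds of the form B eta^|S| from the induction become W eta^|S|, so that the
   moment estimate involves W alone. *)
case: (lerP W B) => // BW; have W0 := le_lt_trans B0 BW.
have WE : W = Exp mu (fun x => f x * g x) by exact: norm2sq_ESdeg.
have al0 : 0 < Exp mu f.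
  rewrite lt_neqAle al_ge0 andbT eq_sym; apply/negP => /eqP al0.
  have := Exp_cauchy f g; rewrite -WE.
  have -> : (fun y => f y ^+ 2) = f.
    by apply/funext => y; case: (f01 y) => ->; rewrite ?expr0n ?expr1n.
  by rewrite al0 mul0r leNgt exprn_gt0.
set K := L / d%:R; have KL : K * d%:R = L by rewrite mulfVK // gt_eqF.
have K4 : 4 <= K by rewrite ler_pdivlMr.
have K0 : 0 < K by lra.
have /andP[kK Kk] := truncn_itv (ltW K0).
have k4 : (4 <= Num.truncn K)%N by rewrite truncn_ge_nat // ltW.
(* Now k = p + 1 = floor K; 4 d <= L gives k >= 4, that is p >= 3 as [noise_step] requires. *)
case kE : (Num.truncn K) k4 kK Kk => [//|p] p3 kK Kk; rewrite ltnS in p3.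
pose eta := 16 / (2200 * K).
have eta0 : 0 <= eta by rewrite divr_ge0 // mulr_ge0 // ltW.
have sup S x : EopS mu (~: S) (fun y => LopS mu S g y ^+ 2) x <= W * eta ^+ #|S|.
  case: (leqP #|S| d) => [Sd|dS]; last first.
    rewrite LopS_ESdeg_eq0 // expr0n EopS_cst mulr_ge0 ?exprn_ge0 //.
    exact: ltW.
  case: (posnP #|S|) => [/eqP|S0].
    rewrite cards_eq0 => /eqP ->; rewrite cards0 expr0 mulr1 setC0 EopS_setT.
    by rewrite /LopS enum_set0.
  rewrite LopS_predegree.
  have IH y : EopS mu (~: S) (fun u => predegree S d f u ^+ 2) y <=
    (r ^+ #|S| * be) ^+ 2 * (2200 * r ^+ 2 * L / (d - #|S|)%:R) ^+ (d - #|S|).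
    rewrite EopS_predegree_sqr //; apply: IHd => //.
    - by rewrite ltn_subrL S0.
    - by move=> u; exact: f01.
    - by rewrite mulr_gt0 ?exprn_gt0.
    - apply: (le_trans beL); rewrite -mulrA ler_peMl ?exprn_ege1 ?ltW //.
      by rewrite mulr_gt0 ?expR_gt0.
    - apply: le_trans dL; rewrite ler_pM2l // ler_nat; exact: leq_subr.
    - move=> T u Td; rewrite /Erestr restr_restr.
      have ST : (#|S :|: T| <= #|S| + #|T|)%N.
        by rewrite cardsU leq_subr.
      have STd : (#|S :|: T| <= d)%N.
        by apply: (leq_trans ST); rewrite -leq_subRL.
      apply: (le_trans (glob _ _ STd)); rewrite mulrA -exprD ler_pM2r //.
      by rewrite addnC; apply: ler_weXn2l; [exact: ltW | exact: ST].
  apply: (le_trans (EopS_LopS_sqr_le S IH x)).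
  apply: (@le_trans _ _ (B * eta ^+ #|S|)).
    by apply: derivative_weight_le => //; rewrite S0.
  by rewrite ler_wpM2r ?exprn_ge0 // ltW.
have k0 : 0 < 5 * p.+1%:R :> R by rewrite mulr_gt0 ?ltr0n.
pose rho := Num.sqrt (5 * p.+1%:R)^-1 : R.
have rho0 : 0 <= rho by exact: sqrtr_ge0.
have rhop : rho ^+ 2 * (5 * p.+1%:R) = 1.
  by rewrite sqr_sqrtr ?invr_ge0 ?ltW // mulVf // gt_eqF.
pose kap : R := (3 * p.+1%:R) ^+ p.+1; pose z := kap * eta ^+ p.
have z0 : 0 <= z by rewrite mulr_ge0 ?exprn_ge0 // mulr_ge0.
have z1 : z <= 1 by exact: noise_weight_le1.
have ExpZ c h : Exp mu (fun x => c * h x) = c * Exp mu h.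
  by rewrite /Exp mulr_sumr; apply: eq_bigr => x _; ring.
have hM : (rho ^+ d) ^+ (2 * p.+1) * Exp mu (fun x => (g x ^+ 2) ^+ p.+1) <=
          W ^+ p * ((1 + z) ^+ d * W).
  have in0 i : (i \in enum 'I_n) =
      (i \notin (set0 : {set 'I_n})) && (i \notin (set0 : {set 'I_n})).
    by rewrite mem_enum !inE.
  have dis0 : [disjoint (set0 : {set 'I_n}) & (set0 : {set 'I_n})].
    by rewrite disjoints_subset sub0set.
  have := @noise_moment_le p rho eta W kap z g set0 set0 (enum 'I_n) p3 rho0 rhop
    (ltW W0) eta0 sup (enum_uniq _) in0 dis0 erefl erefl.
  rewrite cards0 !expr0 mul1r mulr1 /LopS /EopS !enum_set0 /=.
  have -> : mixops rho (1 - rho) (enum 'I_n) g = fun x => rho ^+ d * g x.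
    have := mixops_ESdeg (rho - 1) d f.
    by rewrite opprB addrC subrK.
  rewrite mixops_ESdeg -/g.
  have -> : (fun x => g x * ((1 + z) ^+ d * g x)) = (fun x => (1 + z) ^+ d * g x ^+ 2).
    by apply/funext => x; ring.
  have -> : (fun x => ((rho ^+ d * g x) ^+ 2) ^+ p.+1) =
      (fun x => (rho ^+ d) ^+ (2 * p.+1) * (g x ^+ 2) ^+ p.+1).
    by apply/funext => x; rewrite [(_ * g x) ^+ 2]exprMn [LHS]exprMn -[X in X * _]exprM.
  by rewrite !ExpZ.
have LK : L <= p.+2%:R * d%:R by rewrite -KL ler_pM2r // ltW.
have hJ := Exp_jensen g p f01 al0; rewrite -WE in hJ.
have := level_weight_le d0 p3 al0 al_be beL W0 z1 (addr_ge0 ler01 z0) LK rhop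
  hJ hM.
(* Contradiction: W <= be^2 (160 k)^d is at most B because k <= K and r > 1. *)
move: BW; rewrite ltNge => /negP BW hW; case: BW; apply: (le_trans hW).
rewrite ler_pM2l ?exprn_gt0 //.
have XE : 2200 * r ^+ 2 * L / d%:R = 2200 * r ^+ 2 * K by rewrite /K mulrA.
have r2 : 1 <= r ^+ 2 by rewrite exprn_ege1 // ltW.
have p0 : 0 <= p.+1%:R :> R by rewrite ler0n.
by rewrite XE lerXn2r ?nnegrE; nra.
Qed.

End EfronSteinTheory.

Theorem mainTheorem3 (R : realType) (Omega : finType) (mu : Omega -> R)
  (n : nat) (f : pt Omega n -> R) (r : R) (d : nat) :
  (forall a, 0 <= mu a) -> \sum_(a : Omega) mu a = 1 ->
  (forall x, f x = 0 \/ f x = 1) ->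
  0 < Exp mu f ->
  1 < r ->
  d%:R <= ln (1 / Exp mu f) / 4 ->
  (forall (S : {set 'I_n}) (x : pt Omega n), (#|S| <= d)%N ->
     Erestr mu S x f <= r ^+ #|S| * Exp mu f) ->
  norm2sq mu (ESdeg mu d f) <=
    Exp mu f ^+ 2 * (2200 * r ^+ 2 * ln (1 / Exp mu f) / d%:R) ^+ d.
Proof.
move=> mu_ge0 mu_sum1 f01 al0 r1 dL glob.
apply: level_inequality => //; last by lra.
by rewrite lnK ?posrE ?divr_gt0 // mul1r divff // gt_eqF.
Qed.
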